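(* Let $A$ be a 3-dimensional cyclic Leibniz algebra over $\mathbb{C}$. Then $A$ has a generator $a$ with one of the following multiplications, and exactly one of the three types occurs for $A$ (that is, $A$ does not also have a generator with a multiplication of another type in the list): (i) $aa^3 = 0$ ($A$ is nilpotent); (ii) $aa^3 = a^3$; (iii) $aa^3 = a^2 + \gamma a^3$ for precisely one $\gamma \in \mathbb{C}$ such that $\gamma = 0$ or $0 \le \arg(\gamma) < \pi$ (that is, in this case there is exactly one such $\gamma$ in this range for which $A$ has a generator $a$ satisfying $aa^3 = a^2+\gamma a^3$).
   Context: All algebras are over $\mathbb{C}$. A Leibniz algebra is a vector space $A$ with a bilinear product satisfying $x(yz) = (xy)z + y(xz)$ for all $x,y,z \in A$. Powers are defined by $a^1 = a$, $a^{k+1} = a\,a^{k}$. A Leibniz algebra is cyclic if it is generated as an algebra by a single element $a$, called a generator. An $n$-dimensional cyclic Leibniz algebra with generator $a$ has basis $\{a, a^2, \ldots, a^n\}$; its multiplication is determined by $aa^n$, since $a^j A = 0$ for all $j > 1$. The argument is taken in $(-\pi,\pi]$. A Leibniz algebra is nilpotent if its lower central series $A^1 = A$, $A^{k+1} = A A^k$ (the span of products $xy$ with $x\in A$, $y\in A^k$) reaches $0$. *)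

(* Defs.v *)
From HB Require Import structures.
From mathcomp Require Import all_boot all_order all_algebra.
From mathcomp Require Import all_classical all_reals all_analysis.
From mathcomp Require Import complex.

Set Implicit Arguments.
Unset Strict Implicit.
Unset Printing Implicit Defensive.

Import Order.TTheory GRing.Theory Num.Theory.
Local Open Scope ring_scope.

(* The principal argument, in ]-pi, pi]. For [z = 0] every [t] satisfies the
   polar equation, so [arg 0] is an unspecified element of ]-pi, pi]. *)
Definition arg (R : realType) (z : R[i]) : R :=
  xget 0 [set t : R | - pi < t <= pi /\
    z = `|z| * (cos t +i* sin t)%C].

Section Leibniz.
Variables (K : fieldType) (A : vectType K) (mul : {bilinear A -> A -> A}).

Definition leibniz_identity : Prop :=
  forall x y z : A, mul x (mul y z) = mul (mul x y) z + mul y (mul x z).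

(* a^k for k >= 1; the value at k = 0 is a dummy. *)
Definition lpow (a : A) (k : nat) : A := iter k.-1 (mul a) a.

Definition subalgebra_closed (U : {vspace A}) : Prop :=
  forall x y : A, x \in U -> y \in U -> mul x y \in U.

Definition leibniz_generator (a : A) : Prop :=
  forall U : {vspace A}, a \in U -> subalgebra_closed U -> U = fullv.

Definition leibniz_cyclic : Prop := exists a : A, leibniz_generator a.

(* By bilinearity, products of basis vectors span all the products. *)
Definition mulv (U V : {vspace A}) : {vspace A} :=
  <<[seq mul x y | x <- vbasis U, y <- vbasis V]>>%VS.

Lemma mulv_subP (U V W : {vspace A}) :
  (mulv U V <= W)%VS <->
  (forall x y : A, x \in U -> y \in V -> mul x y \in W).
Proof.
split=> [/subvP sUVW x y xU yV|sUVW].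
  rewrite (coord_vbasis xU) (coord_vbasis yV) linear_sumlz.
  apply: rpred_sum => i _; rewrite linearZl_LR rpredZ //.
  rewrite linear_sumr; apply: rpred_sum => j _; rewrite linearZr_LR rpredZ //.
  by apply/sUVW/memv_span/allpairs_f; apply: mem_nth; rewrite size_tuple.
apply/span_subvP => _ /allpairsP[[x y] /= [xU yV ->]].
by apply: sUVW; exact: vbasis_mem.
Qed.

(* A^k for k >= 1; the value at k = 0 is a dummy. *)
Definition lower_central (k : nat) : {vspace A} :=
  iter k.-1 (mulv fullv) fullv.

Definition leibniz_nilpotent : Prop :=
  exists2 k : nat, (0 < k)%N & lower_central k = 0%VS.

Definition type_i : Prop :=
  exists2 a : A, leibniz_generator a & mul a (lpow a 3) = 0.

Definition type_ii : Prop :=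
  exists2 a : A, leibniz_generator a & mul a (lpow a 3) = lpow a 3.

Definition type_iii (gamma : K) : Prop :=
  exists2 a : A, leibniz_generator a &
    mul a (lpow a 3) = lpow a 2 + gamma *: lpow a 3.

End Leibniz.

Definition normalized (R : realType) (gamma : R[i]) : Prop :=
  gamma = 0 \/ 0 <= arg gamma < pi.

(* Main.v *)
(* By the Leibniz identity the powers a^k with k > 1 annihilate A from the left,
   and a generator a of a 3-dimensional A has basis a, a^2, a^3; hence
   a a^3 = beta a^2 + gamma a^3.  For another generator b, left multiplication
   by b is c times left multiplication by a for some c <> 0, which turns
   (beta, gamma) into (c^2 beta, c gamma); conversely c a realises this change.
   The orbits of this scaling action are represented by (0, 0), (0, 1) and
   (1, gamma) with gamma unique up to sign, and the condition on the argument
   selects one of gamma and - gamma. *)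
Require Import Defs.
From mathcomp Require Import all_boot all_order all_algebra.
From mathcomp Require Import all_classical all_reals all_analysis.
From mathcomp Require Import complex.
From mathcomp Require Import ring.
Import Order.TTheory GRing.Theory Num.Theory.
Local Open Scope ring_scope.

Set Implicit Arguments.
Unset Strict Implicit.
Unset Printing Implicit Defensive.

Lemma span_ind (K : fieldType) (V : vectType K) (s : seq V) (P : V -> Prop) :
  P 0 -> (forall c x y, x \in s -> P y -> P (c *: x + y)) ->
  forall v, v \in << s >>%VS -> P v.
Proof.
move=> P0; elim: s => [|x s IHs] PS v; first by rewrite span_nil memv0 => /eqP->.
rewrite span_cons => /memv_addP[_ /vlineP[c ->] [w ws ->]].
apply: (PS); first by rewrite mem_head.
by apply: IHs ws => d y z ys; apply: PS; rewrite inE ys orbT.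
Qed.

(** * Powers of an element and left multiplication *)

Section CyclicLeibniz.
Variables (K : fieldType) (A : vectType K) (mul : {bilinear A -> A -> A}).
Hypothesis mul_leibniz : leibniz_identity mul.

Definition powers (a : A) (k : nat) : seq A :=
  mkseq (fun i => lpow mul a i.+1) k.

(** Types (i), (ii) and (iii) are the pairs [(0, 0)], [(0, 1)] and [(1, gamma)], so one scaling
    argument treats them all. *)
Definition generator_type (beta gamma : K) : Prop :=
  exists2 a : A, leibniz_generator mul a &
    mul a (lpow mul a 3) = beta *: lpow mul a 2 + gamma *: lpow mul a 3.

Lemma lpowS (a : A) k : lpow mul a k.+2 = mul a (lpow mul a k.+1).
Proof. by []. Qed.

(** The Leibniz identity on [a, a, x] reads [a(ax) = (aa)x + a(ax)], so [(aa)x = 0]; on [a, a^k, x]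
    it passes the vanishing from [a^k] to [a^(k+1)]. *)
Lemma lpow_mul0 (a : A) k x : mul (lpow mul a k.+2) x = 0.
Proof.
elim: k x => [|k IHk] x.
  by apply: (addIr (mul a (mul a x))); rewrite -mul_leibniz add0r.
have := mul_leibniz a (lpow mul a k.+2) x.
by rewrite !IHk linear0r addr0 => /esym.
Qed.

(** Higher powers annihilate from the left, so [c] is the coefficient of [a] in [b]. *)
Lemma left_mul_scale (a b : A) k : b \in << powers a k >>%VS ->
  exists c, forall x, mul b x = c *: mul a x.
Proof.
elim/span_ind: b / => [|c x y /mapP[i _ ->] [d yE]].
  by exists 0 => x; rewrite linear0l scale0r.
case: i => [|i]; [exists (c + d) | exists d] => z.
  by rewrite linearPl yE scalerDl.
by rewrite linearPl lpow_mul0 scaler0 add0r.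
Qed.

Lemma generator_scale (a : A) c : c != 0 ->
  leibniz_generator mul a -> leibniz_generator mul (c *: a).
Proof.
move=> c0 agen U caU; apply: agen.
by rewrite -[a](scalerK c0) rpredZ.
Qed.

Lemma lpow_scale (a : A) c k :
  lpow mul (c *: a) k.+1 = c ^+ k.+1 *: lpow mul a k.+1.
Proof.
elim: k => [//|k IHk]; rewrite !lpowS IHk.
by rewrite linearZl_LR linearZr_LR scalerA -exprS.
Qed.

(** * Independence of the powers of a generator, and the relation for [a a^3] *)

Section Generator.
Variable a : A.
Hypothesis agen : leibniz_generator mul a.

(** Otherwise the span of the first [k] powers contains [a] and is stable under left multiplication
    by [a], hence is a subalgebra; it would be all of [A], with dimension at most [k]. *)
Lemma generator_notin k : (k < \dim {:A})%N ->
  lpow mul a k.+1 \notin << powers a k >>%VS.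
Proof.
apply: contraL => akP; rewrite -leqNgt.
suff <- : << powers a k >>%VS = fullv.
  by apply: leq_trans (dim_span _) _; rewrite size_mkseq.
apply: agen => [|x y /left_mul_scale[c ->] yU].
  by case: k akP => // k _; apply/memv_span/(map_f _ (mem_iota 0 k.+1 0)).
rewrite rpredZ //; elim/span_ind: y / yU => [|d _ y /mapP[i ik ->] IHy].
  by rewrite linear0r mem0v.
rewrite linearPr rpredD ?rpredZ //.
(* The shift leaves the list only when [i + 1 = k], and then lands on the power assumed to lie in
   the span. *)
move: ik; rewrite mem_iota /= add0n (leq_eqVlt _ k) => /predU1P[ik|ik].
  by rewrite -lpowS ik.
by apply/memv_span/mapP; exists i.+1; rewrite ?mem_iota.
Qed.

Lemma generator_free k : (k <= \dim {:A})%N -> free (powers a k).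
Proof.
elim: k => [|k IHk] kA; first by rewrite nil_free.
rewrite /powers mkseqS (perm_free (Y := lpow mul a k.+1 :: powers a k)).
  by rewrite free_cons generator_notin // IHk // ltnW.
by rewrite perm_rcons.
Qed.

Lemma generator_span : << powers a (\dim {:A}) >>%VS = fullv.
Proof.
apply/eqP; rewrite eqEdim subvf /=.
by have /eqP-> := generator_free (leqnn _); rewrite size_mkseq.
Qed.

Lemma left_mul_generator (b : A) : exists c, forall x, mul b x = c *: mul a x.
Proof.
by apply: (@left_mul_scale _ _ (\dim {:A})); rewrite generator_span memvf.
Qed.

Hypothesis dimA : \dim {:A} = 3%N.

Lemma lpow2_neq0 : lpow mul a 2 != 0.
Proof.
have := @generator_notin 1; rewrite dimA => /(_ isT).
by apply: contraNneq => ->; rewrite mem0v.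
Qed.

Lemma lpow23_inj (b1 g1 b2 g2 : K) :
  b1 *: lpow mul a 2 + g1 *: lpow mul a 3 =
  b2 *: lpow mul a 2 + g2 *: lpow mul a 3 -> b1 = b2 /\ g1 = g2.
Proof.
move=> E.
have Eg : (g1 - g2) *: lpow mul a 3 = (b2 - b1) *: lpow mul a 2.
  by rewrite !scalerBl; apply/eqP; rewrite subr_eq addrAC eq_sym subr_eq
    -E addrC.
have g0 : g1 - g2 = 0.
  have := @generator_notin 2; rewrite dimA => /(_ isT).
  have [//|g0] := eqVneq (g1 - g2) 0.
  have : lpow mul a 3 = ((g1 - g2)^-1 * (b2 - b1)) *: lpow mul a 2.
    by rewrite -scalerA -Eg scalerA mulVf // scale1r.
  by move=> ->; rewrite rpredZ // memv_span // !inE eqxx orbT.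
move/eqP: Eg; rewrite g0 scale0r eq_sym scaler_eq0 (negPf lpow2_neq0) orbF.
by rewrite subr_eq0 => /eqP ->; split=> //; apply/eqP; rewrite -subr_eq0 g0.
Qed.

(** Expand [a^4] in the basis of powers; right multiplication by [a] kills all terms except
    [al a^2], so [al = 0]. *)
Lemma generator_relation : exists beta gamma,
  mul a (lpow mul a 3) = beta *: lpow mul a 2 + gamma *: lpow mul a 3.
Proof.
have := memvf (lpow mul a 4).
rewrite -generator_span dimA [powers a 3]/= /mkseq /= !span_cons span_nil addv0.
move=> /memv_addP[_ /vlineP[al ->] [v /memv_addP[_ /vlineP[be ->] [_
  /vlineP[ga ->] ->]] E]].
have := lpow_mul0 a 2 a.
rewrite E !linearDl !linearZl_LR.
rewrite !lpow_mul0 !scaler0 !addr0 => /eqP.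
rewrite scaler_eq0 (negPf lpow2_neq0) orbF => /eqP al0.
by exists be, ga; rewrite -lpowS E al0 scale0r add0r.
Qed.

(* Cayley-Hamilton for left multiplication by the generator. *)
Lemma left_mul_cubed beta gamma (x : A) :
  mul a (lpow mul a 3) = beta *: lpow mul a 2 + gamma *: lpow mul a 3 ->
  mul a (mul a (mul a x)) = beta *: mul a x + gamma *: mul a (mul a x).
Proof.
move=> E; have : x \in << powers a 3 >>%VS by rewrite -dimA generator_span memvf.
elim/span_ind: x / => [|c _ x /mapP[i _ ->] IHx].
  by rewrite !linear0r !scaler0 addr0.
have {}E : mul a (mul a (mul a (lpow mul a i.+1))) =
    beta *: mul a (lpow mul a i.+1) + gamma *: mul a (mul a (lpow mul a i.+1)).
  elim: i => [|i IHi]; first exact: E.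
  by rewrite !lpowS IHi linearDr !linearZr_LR -IHi.
rewrite !linearPr E IHx !scalerDr !scalerA ![c * _]mulrC -!addrA.
by congr (_ + _); rewrite addrCA.
Qed.

(** Every product is a multiple of a value of [T], so [A^4] lies in [T^3(A)], which is zero by
    [left_mul_cubed] with both coefficients 0. *)
Lemma lower_central4 : mul a (lpow mul a 3) = 0 -> lower_central mul 4 = 0%VS.
Proof.
move=> a3; pose T := linfun (mul a).
have mulvT (U : {vspace A}) : (mulv mul fullv U <= T @: U)%VS.
  apply/mulv_subP => x y _ yU; have [c ->] := left_mul_generator x.
  by rewrite rpredZ // -[mul a y]lfunE memv_img.
apply/eqP; rewrite -subv0.
apply: subv_trans (mulvT _) _.
apply: subv_trans (limgS _ (mulvT _)) _.
apply: subv_trans (limgS _ (limgS _ (mulvT _))) _.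
apply/subvP => _ /memv_imgP[_ /memv_imgP[_ /memv_imgP[x _ ->] ->] ->].
by rewrite !lfunE /= (@left_mul_cubed 0 0) ?scale0r ?addr0 ?mem0v //.
Qed.

End Generator.

(* The left annihilator contains all higher powers, so left multiplication by
   another generator is a multiple c of left multiplication by a, and the
   characteristic polynomial X (X^2 - gamma X - beta) is rescaled by c. *)
Lemma generator_relation_scale (a b : A) beta gamma beta' gamma' :
  \dim {:A} = 3%N ->
  leibniz_generator mul a -> leibniz_generator mul b ->
  mul a (lpow mul a 3) = beta *: lpow mul a 2 + gamma *: lpow mul a 3 ->
  mul b (lpow mul b 3) = beta' *: lpow mul b 2 + gamma' *: lpow mul b 3 ->
  exists c, [/\ c != 0, beta' = c ^+ 2 * beta & gamma' = c * gamma].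
Proof.
move=> dimA agen bgen E E'; have [c cE] := left_mul_generator agen b.
have c0 : c != 0.
  have := lpow2_neq0 bgen dimA; rewrite lpowS cE.
  by apply: contraNneq => ->; rewrite scale0r.
suff /(lpow23_inj bgen dimA)[] : beta' *: lpow mul b 2 + gamma' *: lpow mul b 3 =
    (c ^+ 2 * beta) *: lpow mul b 2 + (c * gamma) *: lpow mul b 3 by exists c.
rewrite -E' !lpowS !cE !linearZr_LR (left_mul_cubed agen dimA _ E) !scalerDr !scalerA.
by congr (_ *: _ + _ *: _); ring.
Qed.

(** * The pairs [(beta, gamma)] of an algebra form one scaling orbit *)

Lemma generator_type_ex : \dim {:A} = 3%N -> leibniz_cyclic mul ->
  exists beta gamma, generator_type beta gamma.
Proof.
move=> dimA [a agen]; have [be [ga E]] := generator_relation agen dimA.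
by exists be, ga, a.
Qed.

Lemma generator_type_scale beta gamma c : c != 0 ->
  generator_type beta gamma -> generator_type (c ^+ 2 * beta) (c * gamma).
Proof.
move=> c0 [a agen E]; exists (c *: a); first exact: generator_scale.
rewrite !lpow_scale linearZl_LR linearZr_LR E !scalerDr !scalerA -!mulrA.
by congr (_ *: _ + _ *: _); rewrite ?exprS expr0; ring.
Qed.

Lemma generator_type_eq beta gamma beta' gamma' : \dim {:A} = 3%N ->
  generator_type beta gamma -> generator_type beta' gamma' ->
  exists c, [/\ c != 0, beta' = c ^+ 2 * beta & gamma' = c * gamma].
Proof.
by move=> dimA [a agen E] [b bgen E']; apply: generator_relation_scale E E'.
Qed.

Lemma type_iE : type_i mul <-> generator_type 0 0.
Proof. by split=> -[a agen E]; exists a; rewrite // E !scale0r addr0. Qed.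

Lemma type_iiE : type_ii mul <-> generator_type 0 1.
Proof.
by split=> -[a agen E]; exists a; rewrite // E scale0r scale1r add0r.
Qed.

Lemma type_iiiE gamma : type_iii mul gamma <-> generator_type 1 gamma.
Proof. by split=> -[a agen E]; exists a; rewrite // E scale1r. Qed.

Lemma type_i_nilpotent : \dim {:A} = 3%N -> type_i mul -> leibniz_nilpotent mul.
Proof.
by move=> dimA [a agen E]; exists 4%N; rewrite // (lower_central4 agen).
Qed.

End CyclicLeibniz.

(** * The argument, and the choice between [z] and [- z] *)

Section Normalized.
Variable R : realType.
Local Open Scope complex_scope.

(** For nonzero [z] the angle is [acos (x / r)], negated when [y < 0], since [r sin (acos (x / r)) =
    sqrt (r^2 - x^2) = |y|]. *)
Lemma polar_form (z : R[i]) :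
  exists t : R, - pi < t <= pi /\ z = `|z| * (cos t +i* sin t).
Proof.
have [->|z0] := eqVneq z 0.
  by exists 0; rewrite normr0 mul0r oppr_lt0 pi_gt0 pi_ge0.
rewrite normc_def; case: z z0 => x y z0 /=.
set r := Num.sqrt _; have r2 : r ^+ 2 = x ^+ 2 + y ^+ 2.
  by rewrite sqr_sqrtr // addr_ge0 ?sqr_ge0.
have r_gt0 : 0 < r.
  rewrite sqrtr_gt0 lt0r addr_ge0 ?sqr_ge0 // andbT paddr_eq0 ?sqr_ge0 //.
  by move: z0; rewrite eq_complex /= !sqrf_eq0.
have r0 : r != 0 by rewrite gt_eqF.
have xr : -1 <= x / r <= 1.
  rewrite -ler_norml -(@ler_pXn2r _ 2) ?nnegrE // expr1n real_normK ?num_real //.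
  by rewrite expr_div_n ler_pdivrMr ?exprn_gt0 // mul1r r2 lerDl sqr_ge0.
have rsin : r * sin (acos (x / r)) = `|y|.
  rewrite sin_acos // -{1}(gtr0_norm r_gt0) -sqrtr_sqr -sqrtrM ?sqr_ge0 //.
  rewrite mulrBr mulr1 -exprMn [r * (x / r)]mulrC divfK // r2.
  by rewrite addrAC subrr add0r sqrtr_sqr.
have rcos : r * cos (acos (x / r)) = x.
  by rewrite acosK ?in_itv //= mulrCA mulfV // mulr1.
have Eprod u v : r%:C * (u +i* v) = (r * u) +i* (r * v).
  by simpc.
have [y0|y0] := leP 0 y.
  exists (acos (x / r)); rewrite Eprod rcos rsin ger0_norm //; split => //.
  by rewrite acos_lepi // andbT (lt_le_trans _ (acos_ge0 xr)) // oppr_lt0 pi_gt0.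
exists (- acos (x / r)); rewrite Eprod cosN sinN mulrN rcos rsin ltr0_norm //.
rewrite opprK; split => //; apply/andP; split; last first.
  by rewrite (le_trans _ (pi_ge0 _)) // oppr_le0 acos_ge0.
(* The bound [- pi] is strict: reaching it needs [x = - r], hence [y = 0], against [y < 0]. *)
rewrite ltrN2 acos_ltpi //; case/andP: xr => xr ->; rewrite andbT lt_neqAle xr.
rewrite andbT; apply: contraTneq y0 => /esym E.
have : x ^+ 2 = r ^+ 2 by rewrite -rcos acosK ?in_itv /= ?E ?lexx ?lerN10 //
  ?mulrN1 ?sqrrN // (le_trans (lerN10 _)) ?ler01.
rewrite r2 => /eqP; rewrite -subr_eq0 opprD addrA subrr add0r oppr_eq0 sqrf_eq0.
by move=> /eqP ->; rewrite ltxx.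
Qed.

(** By [polar_form] the set defining [arg] is nonempty, so [xget] returns one of its members. *)
Lemma arg_polar (z : R[i]) :
  - pi < arg z <= pi /\ z = `|z| * (cos (arg z) +i* sin (arg z)).
Proof.
have [t tP] := polar_form z.
exact: (@xgetPex _ 0 [set t : R | _] (ex_intro _ t tP)).
Qed.

(** Sign conditions are easy to compare for [z] and [- z]. The signs are those of [sin t] and
    [cos t]; where the sine vanishes, the cosine separates [t = 0] from [t = pi]. *)
Lemma argP (z : R[i]) : z != 0 ->
  (0 <= arg z < pi) =
  (0 < complex.Im z) || (complex.Im z == 0) && (0 < complex.Re z).
Proof.
have [] := arg_polar z; set t := arg z => /andP[tgt tle] zE z0.
have : 0 < `|z| by rewrite normr_gt0.
rewrite normc_def in zE *; set r := Num.sqrt _ in zE *.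
rewrite ltcR => r0.
have [-> ->] : complex.Re z = r * cos t /\ complex.Im z = r * sin t.
  by rewrite [in complex.Re z]zE [in complex.Im z]zE /=; split; simpc.
rewrite !pmulr_rgt0 // mulf_eq0 (gt_eqF r0) /=.
have [t0|t0|<-] := ltgtP 0 t; last by rewrite sin0 cos0 ltxx eqxx ltr01 pi_gt0.
  have [tpi|tpi] := ltP t pi; first by rewrite sin_gt0_pi ?t0.
  have -> : t = pi by apply/eqP; rewrite eq_le tle tpi.
  by rewrite sinpi cospi ltxx eqxx oppr_gt0 ltr10.
have : 0 < sin (- t) by rewrite sin_gt0_pi // oppr_gt0 t0 ltrNl.
by rewrite sinN oppr_gt0 => st; rewrite /= lt_gtF // lt_eqF.
Qed.

(** The region of [argP] and its opposite cover the nonzero numbers; this gives existence of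
    [gamma]. *)
Lemma normalizedN (z : R[i]) : normalized z \/ normalized (- z).
Proof.
have [->|z0] := eqVneq z 0; first by left; left.
rewrite /normalized !argP ?oppr_eq0 //; case: z z0 => x y /=.
rewrite eq_complex /= !oppr_gt0 oppr_eq0.
by case: (ltgtP y 0) => //=; case: (ltgtP x 0) => //=; auto.
Qed.

(** The same two regions are disjoint; this gives uniqueness of [gamma]. *)
Lemma normalized_eqN (z : R[i]) : normalized z -> normalized (- z) -> z = 0.
Proof.
have [//|z0] := eqVneq z 0.
case=> [->//|]; rewrite argP // => Hz [/eqP|]; first by rewrite oppr_eq0 => /eqP.
rewrite argP ?oppr_eq0 //; case: z z0 Hz => x y /=.
rewrite eq_complex /= !oppr_gt0 oppr_eq0.
by case: (ltgtP y 0) => //=; case: (ltgtP x 0).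
Qed.

End Normalized.

(** * Classification by scaling orbits *)

Theorem theorem1 (R : realType) (A : vectType R[i])
    (mul : {bilinear A -> A -> A})
    (mul_leibniz : leibniz_identity mul)
    (dimA : \dim {:A} = 3%N)
    (cyclicA : leibniz_cyclic mul) :
  [\/ [/\ type_i mul, leibniz_nilpotent mul, ~ type_ii mul
        & ~ (exists gamma : R[i], normalized gamma /\ type_iii mul gamma)],
      [/\ type_ii mul, ~ type_i mul
        & ~ (exists gamma : R[i], normalized gamma /\ type_iii mul gamma)]
    | [/\ (exists! gamma : R[i], normalized gamma /\ type_iii mul gamma),
          ~ type_i mul & ~ type_ii mul]].
Proof.
have sep := generator_type_eq mul_leibniz dimA.
have sep_i_ii : type_i mul -> ~ type_ii mul.
  move=> /type_iE ti /type_iiE /(sep _ _ _ _ ti)[c [_ _ /eqP]].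
  by rewrite mulr0 oner_eq0.
(* Scaling gives [1 = c^2 be]; with [be = 0] this excludes types (i) and (ii) alike. *)
have sep_iii be (ga ga' : R[i]) : type_iii mul ga -> generator_type mul be ga' ->
    be <> 0.
  move=> /type_iiiE ti tb be0; have [c [_ /eqP]] := sep _ _ _ _ tb ti.
  by rewrite be0 mulr0 oner_eq0.
have [be [ga t]] := generator_type_ex mul_leibniz dimA cyclicA.
have [be0|be0] := eqVneq be 0; last first.
  (* Scaling by [c / s] makes [beta] equal to 1 for both [c = 1] and [c = - 1], leaving the sign of
     [gamma] free for normalization. *)
  pose s := sqrtC be; have s0 : s != 0 by rewrite sqrtC_eq0.
  have t1 c : c ^+ 2 = 1 -> generator_type mul 1 (c * (s^-1 * ga)).
    move=> c1; have c0 : c != 0 by rewrite -sqrf_eq0 c1 oner_eq0.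
    have := generator_type_scale (mulf_neq0 c0 (invr_neq0 s0)) t.
    by rewrite exprMn c1 mul1r exprVn sqrtCK mulVf // mulrA.
  have [g [gn tg]] : exists g : R[i], normalized g /\ type_iii mul g.
    have [n|n] := normalizedN (s^-1 * ga).
      exists (s^-1 * ga); split=> //; apply/type_iiiE.
      by have := t1 1; rewrite expr1n mul1r; apply.
    exists (- (s^-1 * ga)); split=> //; apply/type_iiiE.
    by have := t1 (- 1); rewrite sqrrN expr1n mulN1r; apply.
  apply: Or33; split; last by move=> /type_iiE /(sep_iii _ _ _ tg).
    exists g; split=> // g' [gn' /type_iiiE tg'].
    (* Both pairs have [beta = 1], so [c^2 = 1] and [g' = g] or [g' = - g]; in the second case both
       vanish. *)
    have /type_iiiE tg1 := tg; have [c [_ /esym/eqP]] := sep _ _ _ _ tg1 tg'.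
    rewrite mulr1 sqrf_eq1 => /orP[] /eqP -> g'E; first by rewrite g'E mul1r.
    move: gn'; rewrite g'E mulN1r => gn'.
    by rewrite (normalized_eqN gn gn') oppr0.
  by move=> /type_iE /(sep_iii _ _ _ tg).
have not_iii : ~ (exists gamma : R[i], normalized gamma /\ type_iii mul gamma).
  by move=> [g [_ tg]]; apply: (sep_iii _ _ _ tg t).
have [ga0|ga0] := eqVneq ga 0.
  have ti : type_i mul by apply/type_iE; move: t; rewrite be0 ga0.
  by apply: Or31; split=> //; [exact: type_i_nilpotent | exact: sep_i_ii].
(* Scaling by [ga^-1] brings [(0, ga)] to [(0, 1)]. *)
apply: Or32; have tii : type_ii mul.
  apply/type_iiE; have := generator_type_scale (invr_neq0 ga0) t.
  by rewrite be0 mulr0 mulVf.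
by split=> // ti; apply: sep_i_ii ti tii.
Qed.
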